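(* Let $q$ be a positive integer. Then: (1) Up to scalars, $L_{0,0}$ is the unique $\mathrm{ad}$-locally finite element of $\mathcal{B}(q)$ (i.e. the $\mathrm{ad}$-locally finite elements of $\mathcal{B}(q)$ are exactly the scalar multiples of $L_{0,0}$). (2) $L_{0,0}$ is not $\mathrm{ad}$-locally nilpotent, and thus $\mathrm{Int}\,\mathcal{B}(q)$ is trivial.
   Context: $\mathbb{Z}_+$ denotes the set of nonnegative integers. For a positive integer $q$, $\mathcal{B}(q)$ is the complex Lie algebra with basis $\{L_{\alpha,i}\mid \alpha\in\mathbb{Z},\ i\in\mathbb{Z}_+\}$ and bracket $[L_{\alpha,i},L_{\beta,j}]=(\beta(i+q)-\alpha(j+q))L_{\alpha+\beta,i+j}$. An element $F\in\mathcal{B}(q)$ is $\mathrm{ad}$-locally finite if for every $v\in\mathcal{B}(q)$ the subspace $\mathrm{Span}\{\mathrm{ad}_F^m(v)\mid m\in\mathbb{Z}_+\}$ is finite dimensional; it is $\mathrm{ad}$-locally nilpotent if for every $v\in\mathcal{B}(q)$ there is some $N>0$ with $\mathrm{ad}_F^N(v)=0$. $\mathrm{Int}\,\mathcal{B}(q)$ is the inner automorphism group, i.e. the subgroup of the automorphism group of $\mathcal{B}(q)$ generated by $\exp(\mathrm{ad}_x)$ for $\mathrm{ad}$-locally nilpotent elements $x\in\mathcal{B}(q)$. *)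

(* Defs.v *)
From HB Require Import structures.
From mathcomp Require Import all_boot all_order all_algebra.
From mathcomp Require Import finmap.
From mathcomp.classical Require Import boolp classical_sets.
From mathcomp Require Import reals.
From mathcomp.real_closed Require Import complex.
From mathcomp.multinomials Require Import monalg.
From mathcomp Require Import ring.

Set Implicit Arguments.
Unset Strict Implicit.
Unset Printing Implicit Defensive.

Import Order.TTheory GRing.Theory Num.Theory.
Local Open Scope classical_set_scope.
Local Open Scope ring_scope.

HB.mixin Record Lmodule_isLieAlgebra (K : numFieldType) V
    of GRing.Lmodule K V := {
  lie : V -> V -> V ;
  lie_linearl : forall y, linear (fun x => lie x y) ;
  lie_linearr : forall x, linear (lie x) ;
  liexx : forall x, lie x x = 0 ;
  lie_jacobi : forall x y z,
    lie x (lie y z) + lie y (lie z x) + lie z (lie x y) = 0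
}.

#[short(type="lieAlgType")]
HB.structure Definition LieAlgebra (K : numFieldType) :=
  { V of Lmodule_isLieAlgebra K V & GRing.Lmodule K V }.

Section LinearSpan.
Context (K : numFieldType) (V : lmodType K).

Definition is_subspace (W : set V) : Prop :=
  W 0 /\ forall a u v, W u -> W v -> W (a *: u + v).

Definition linear_span (S : set V) : set V := smallest is_subspace S.

Definition finite_dimensional (W : set V) : Prop :=
  exists s : seq V, W = linear_span [set` s].

End LinearSpan.

Section LieAlgebraTheory.
Context (K : numFieldType) (L : lieAlgType K).
Implicit Types (x u v F : L) (f g : L -> L).

Definition ad x : L -> L := lie x.

Definition ad_locally_finite F : Prop :=
  forall v, finite_dimensional (linear_span (range (fun m => iter m (ad F) v))).

Definition ad_locally_nilpotent F : Prop :=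
  forall v, exists N, (0 < N)%N && (iter N (ad F) v == 0).

(* The series is cut at the least N > 0 with ad_x^N v = 0; all its later terms
   vanish. *)
Definition exp_ad x (nil_x : ad_locally_nilpotent x) : L -> L :=
  fun v => \sum_(m < ex_minn (nil_x v)) (m`!%:R)^-1 *: iter m (ad x) v.

Definition Aut : set (L -> L) :=
  [set f | [/\ linear f, bijective f &
               forall u v, f (lie u v) = lie (f u) (f v)]].

Definition Aut_subgroup (H : set (L -> L)) : Prop :=
  [/\ H `<=` Aut,
      H id,
      forall f g, H f -> H g -> H (f \o g) &
      forall f g, H f -> cancel f g -> cancel g f -> H g].

Definition Int : set (L -> L) :=
  smallest Aut_subgroup
    [set f | exists x (nil_x : ad_locally_nilpotent x), f = exp_ad nil_x].

End LieAlgebraTheory.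

Arguments Aut {K} L.
Arguments Int {K} L.

(* The underlying vector space of B(q) does not depend on q; the parameter is
   kept in the type because the Lie algebra structure depends on it. *)
Definition Bq (R : realType) (q : nat) : Type := {malg R[i][(int * nat)%type]}.

HB.instance Definition _ (R : realType) (q : nat) := GRing.Lmodule.on (Bq R q).

Section MalgLift.
Context (I : choiceType) (K : numFieldType) (V : lmodType K).
Implicit Types (f : I -> V) (u v : {malg K[I]}).

Definition malg_lift f u : V := \sum_(a <- msupp u) u@_a *: f a.

Lemma malg_liftEw f u (d : {fset I}) : (msupp u `<=` d)%fset ->
  malg_lift f u = \sum_(a <- d) u@_a *: f a.
Proof.
move=> ud; rewrite /malg_lift (big_fset_incl _ ud) // => a _ /mcoeff_outdom ->.
by rewrite scale0r.
Qed.

Lemma malg_lift_is_linear f : linear (malg_lift f).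
Proof.
move=> k u v; pose d := (msupp u `|` msupp v)%fset.
have ud : (msupp u `<=` d)%fset by exact: fsubsetUl.
have vd : (msupp v `<=` d)%fset by exact: fsubsetUr.
have kuvd : (msupp (k *: u + v) `<=` d)%fset.
  apply: fsubset_trans (msuppD_le _ _) _.
  by apply: fsetSU; exact: msuppZ_le.
rewrite (malg_liftEw f ud) (malg_liftEw f vd) (malg_liftEw f kuvd).
rewrite scaler_sumr -big_split; apply: eq_bigr => a _ /=.
by rewrite mcoeffD mcoeffZ scalerDl scalerA.
Qed.

HB.instance Definition _ f :=
  GRing.isLinear.Build K {malg K[I]} V *:%R (malg_lift f)
    (malg_lift_is_linear f).

Lemma malg_liftU f a : malg_lift f << a >> = f a.
Proof.
rewrite (malg_liftEw f msuppU_le) big_seq_fset1 mcoeffUU scale1r; exact.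
Qed.

Lemma eq_malg_lift f g u : f =1 g -> malg_lift f u = malg_lift g u.
Proof. by move=> fg; apply: eq_bigr => a _; rewrite fg. Qed.

Lemma malg_liftD f g u :
  malg_lift (fun a => f a + g a) u = malg_lift f u + malg_lift g u.
Proof.
by rewrite -big_split; apply: eq_bigr => a _; rewrite scalerDr.
Qed.

Lemma malg_liftZ k f u :
  malg_lift (fun a => k *: f a) u = k *: malg_lift f u.
Proof.
by rewrite scaler_sumr; apply: eq_bigr => a _; rewrite !scalerA mulrC.
Qed.

Lemma malg_linear_ext (f g : {malg K[I]} -> V) : linear f -> linear g ->
  (forall a, f << a >> = g << a >>) -> f =1 g.
Proof.
have lift_ext h : linear h -> h =1 malg_lift (fun a => h << a >>).
  move=> lh u; pose H := GRing.isLinear.Build K {malg K[I]} V *:%R h lh.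
  pose h' : {linear {malg K[I]} -> V} := HB.pack h H.
  rewrite [u in LHS]monalgE -[LHS]/(h' _) linear_sum; apply: eq_bigr => a _ /=.
  rewrite -[h << a >>]/(h' _) -linearZ; congr (h' _).
  by apply/malgP => b; rewrite mcoeffZ !mcoeffU mulrnAr mulr1.
move=> lf lg fg u; rewrite (lift_ext f) // (lift_ext g) //.
exact: eq_malg_lift.
Qed.

Lemma linear_add3 (U : lmodType K) (f g h : U -> V) :
  linear f -> linear g -> linear h -> linear (fun x => f x + g x + h x).
Proof.
move=> lf lg lh k x y.
by rewrite lf lg lh !scalerDr (addrACA (k *: f x)) [LHS]addrACA.
Qed.

End MalgLift.

Section Bq.
Context (R : realType) (q : nat).
Local Notation B := (Bq R q).
Implicit Types (u v w : B) (a b c : int * nat).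

Definition Lgen (alpha : int) (i : nat) : B := << (alpha, i) >>.

Definition Bq_coef a b : int :=
  b.1 * (a.2 + q)%:Z - a.1 * (b.2 + q)%:Z.

Lemma Bq_coefN a b : Bq_coef a b = - Bq_coef b a.
Proof. by rewrite /Bq_coef; ring. Qed.

Lemma Bq_coef_jacobi a b c :
  Bq_coef b c * Bq_coef a (b.1 + c.1, (b.2 + c.2)%N) +
  Bq_coef c a * Bq_coef b (c.1 + a.1, (c.2 + a.2)%N) +
  Bq_coef a b * Bq_coef c (a.1 + b.1, (a.2 + b.2)%N) = 0.
Proof. by rewrite /Bq_coef /= !PoszD; ring. Qed.

Definition Bq_lie_gen a b : B :=
  (Bq_coef a b)%:~R *: Lgen (a.1 + b.1) (a.2 + b.2)%N.

Definition Bq_lie u v : B :=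
  malg_lift (fun a => malg_lift (Bq_lie_gen a) v) u.

Lemma Bq_lie_linearl v : linear (fun u => Bq_lie u v).
Proof. exact: malg_lift_is_linear. Qed.

Lemma Bq_lie_linearr u : linear (Bq_lie u).
Proof.
move=> k v w; rewrite /Bq_lie -malg_liftZ -malg_liftD.
by apply: eq_malg_lift => a; rewrite linearP.
Qed.

HB.instance Definition _ u :=
  GRing.isLinear.Build R[i] B B *:%R (Bq_lie u) (Bq_lie_linearr u).

Lemma Bq_lieE a b : Bq_lie << a >> << b >> = Bq_lie_gen a b.
Proof. by rewrite /Bq_lie !malg_liftU. Qed.

Lemma Bq_lie_genZ a b c : Bq_lie << a >> (Bq_lie_gen b c) =
  (Bq_coef b c * Bq_coef a (b.1 + c.1, (b.2 + c.2)%N))%:~R *: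
    Lgen (a.1 + (b.1 + c.1)) (a.2 + (b.2 + c.2))%N.
Proof. by rewrite {1}/Bq_lie_gen linearZ /= Bq_lieE scalerA intrM. Qed.

Lemma Bq_lie_anti u v : Bq_lie u v = - Bq_lie v u.
Proof.
move: u; apply: malg_linear_ext => [||a].
- exact: Bq_lie_linearl.
- by move=> k x y; rewrite linearP opprD scalerN.
move: v; apply: malg_linear_ext => [||b].
- exact: Bq_lie_linearr.
- by move=> k x y; rewrite Bq_lie_linearl opprD scalerN.
by rewrite !Bq_lieE /Bq_lie_gen addrC addnC -scaleNr Bq_coefN mulrNz.
Qed.

Lemma Bq_liexx u : Bq_lie u u = 0.
Proof.
have /eqP := Bq_lie_anti u u.
rewrite -addr_eq0 -mulr2n -scaler_nat scaler_eq0 pnatr_eq0 /=.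
by move/eqP.
Qed.

Lemma Bq_lie_jacobi u v w :
  Bq_lie u (Bq_lie v w) + Bq_lie v (Bq_lie w u) + Bq_lie w (Bq_lie u v) = 0.
Proof.
have lin0 : linear (fun _ : B => 0 : B) by move=> k x y; rewrite scaler0 addr0.
move: u; apply: malg_linear_ext => // [|a].
  apply: linear_add3 => k x y; first exact: Bq_lie_linearl.
  - by rewrite !Bq_lie_linearr.
  - by rewrite Bq_lie_linearl linearP.
move: v; apply: malg_linear_ext => // [|b].
  apply: linear_add3 => k x y; last by rewrite !Bq_lie_linearr.
  - by rewrite Bq_lie_linearl linearP.
  - exact: Bq_lie_linearl.
move: w; apply: malg_linear_ext => // [|c].
  apply: linear_add3 => k x y; last exact: Bq_lie_linearl.
  - by rewrite !Bq_lie_linearr.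
  - by rewrite Bq_lie_linearl linearP.
rewrite (Bq_lieE b c) (Bq_lieE c a) (Bq_lieE a b).
rewrite (Bq_lie_genZ a b c) (Bq_lie_genZ b c a) (Bq_lie_genZ c a b).
have -> : b.1 + (c.1 + a.1) = a.1 + (b.1 + c.1) by ring.
have -> : c.1 + (a.1 + b.1) = a.1 + (b.1 + c.1) by ring.
have -> : (b.2 + (c.2 + a.2) = a.2 + (b.2 + c.2))%N by rewrite addnA addnC.
have -> : (c.2 + (a.2 + b.2) = a.2 + (b.2 + c.2))%N by rewrite addnC addnA.
by rewrite -!scalerDl -!intrD Bq_coef_jacobi scale0r.
Qed.

HB.instance Definition _ := Lmodule_isLieAlgebra.Build R[i] B
  Bq_lie_linearl Bq_lie_linearr Bq_liexx Bq_lie_jacobi.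

Lemma lie_LgenE (alpha beta : int) (i j : nat) :
  lie (Lgen alpha i) (Lgen beta j) =
    (beta * (i + q)%:Z - alpha * (j + q)%:Z)%:~R *:
      Lgen (alpha + beta) (i + j)%N.
Proof. exact: Bq_lieE. Qed.

End Bq.

Arguments Lgen R q : clear implicits.

(* Main.v *)
Require Import Defs.
From mathcomp Require Import all_boot all_order all_algebra.
From mathcomp Require Import finmap zify ring.
From mathcomp.classical Require Import boolp classical_sets.
From mathcomp Require Import reals.
From mathcomp.real_closed Require Import complex.
From mathcomp.multinomials Require Import monalg.

(** The algebra B(q) is graded by the monoid Z x N of pairs (alpha, i), so any
    additive phi : Z x N -> Z turns its elements into Laurent-polynomial-like
    objects with a notion of leading exponent: [leads phi a u] says that a is
    the only point of the support of u at which phi is maximal. Leading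
    exponents add up under the bracket as long as the structure constant
    [Bq_coef q a b] does not vanish ([leads_lie]).

    Suppose that F is not a multiple of L_{0,0}. Its support contains a nonzero
    exponent, and for a suitable phi it has a leading exponent a with phi a > 0
    ([exists_leads]). There is a basis vector L_b such that none of the
    structure constants of a with b, b + a, b + 2a, ... vanishes
    ([exists_Bq_coef_neq0]). Hence b + k a is the leading exponent of
    ad_F^k L_b; since phi (b + k a) is unbounded, the vectors ad_F^k L_b do
    not have supports in a common finite set, and so do not span a
    finite-dimensional space ([leads_not_ad_locally_finite]).

    Conversely ad L_{0,0} is diagonal in the basis L_b, with eigenvalue b_1 q.
    Any v involves finitely many eigenvalues, so it is killed by a polynomial
    P in ad L_{0,0}, and reducing X^m modulo P shows that the iterates of
    degree less than that of P span all the others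
    ([ad_locally_finite_L00]). On L_{1,0} the eigenvalue is q, which is
    nonzero: no nonzero multiple of L_{0,0} is locally nilpotent
    ([L00_not_ad_locally_nilpotent]). A locally nilpotent element is locally
    finite, hence a multiple of L_{0,0}, hence zero, and the exponential of
    ad_0 is the identity: the generators of the inner automorphism group are
    trivial ([exp_ad_id]). *)

Set Implicit Arguments.
Unset Strict Implicit.
Unset Printing Implicit Defensive.

Import Order.TTheory GRing.Theory Num.Theory.
Local Open Scope classical_set_scope.
Local Open Scope ring_scope.

(** * Spans of the iterates of a map *)

Section Span.
Context (K : numFieldType) (V : lmodType K).
Implicit Types (S : set V) (T : V -> V) (v : V).

Lemma subspace_linear_span S : is_subspace (linear_span S).
Proof.
split=> [W [[W0 _] _] //|k u v Su Sv W [sW SW]].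
by apply: sW.2; [exact: Su | exact: Sv].
Qed.

Lemma linear_span_sum S (I : Type) (r : seq I) (c : I -> K) (f : I -> V) :
  (forall i, S (f i)) -> linear_span S (\sum_(i <- r) c i *: f i).
Proof.
move=> Sf; have [S0 Slin] := subspace_linear_span S.
elim/big_ind: _ => // [u v Su Sv|i _].
  by rewrite -[u]scale1r; exact: Slin.
by rewrite -[_ *: _]addr0; apply: Slin => //; exact: sub_gen_smallest.
Qed.

Lemma finite_dimensional_iter T v n :
  (forall m, linear_span [set iter k T v | k in [set k | (k < n)%N]]
               (iter m T v)) ->
  finite_dimensional (linear_span (range (fun m => iter m T v))).
Proof.
move=> spanT; exists [seq iter k T v | k <- iota 0 n].
have -> : [set` [seq iter k T v | k <- iota 0 n]] =
          [set iter k T v | k in [set k | (k < n)%N]].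
  apply/seteqP; split=> x /=.
    by move=> /mapP [k]; rewrite mem_iota => kn ->; exists k.
  by move=> [k kn <-]; apply/mapP; exists k => //; rewrite mem_iota.
apply/seteqP; split; apply: smallest_sub; try exact: subspace_linear_span.
  by move=> _ [m _ <-]; exact: spanT.
by move=> _ [k _ <-]; apply: sub_gen_smallest; exists k.
Qed.

End Span.

(** From some rank on the iterates are zero, so the first ones span. *)
Lemma ad_nilpotent_locally_finite (K : numFieldType) (L : lieAlgType K)
    (x : L) : ad_locally_nilpotent x -> ad_locally_finite x.
Proof.
move=> nil_x v; have [N /andP[_ /eqP xN]] := nil_x v.
apply: (@finite_dimensional_iter _ _ _ _ N) => m.
have [mN|Nm] := ltnP m N; first by apply: sub_gen_smallest; exists m.
have ad0 k : iter k (ad x) 0 = 0.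
  elim: k => //= k ->.
  by have /= := GRing.scalable_linear (lie_linearr x) 0 0; rewrite !scale0r.
by rewrite -(subnK Nm) iterD xN ad0; exact: (subspace_linear_span _).1.
Qed.

(** This gives an obstruction to finite dimension: it is enough to produce
    elements of W whose supports lie in no common finite set. *)
Lemma finite_dimensional_supp (I : choiceType) (K : numFieldType)
    (W : set {malg K[I]}) :
  finite_dimensional W ->
  exists d : {fset I}, forall w, W w -> (msupp w `<=` d)%fset.
Proof.
case=> s ->; exists (\bigcup_(w <- s) msupp w)%fset.
apply: (@smallest_sub _ _ _
         [set w | (msupp w `<=` \bigcup_(w <- s) msupp w)%fset]).
  split=> [|k u v /= ud vd]; first by rewrite /= msupp0 fsub0set.
  apply: fsubset_trans (msuppD_le _ _) _; rewrite fsubUset vd andbT.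
  exact: fsubset_trans (msuppZ_le _ _) ud.
by move=> w /= ws; exact: bigfcup_sup.
Qed.

(** * Leading exponents *)

Section Leading.
Context (R : realType) (q : nat).
Local Notation B := (Bq R q).
Implicit Types (F u v w : B) (a b x y : int * nat).

Lemma mcoeff_lieE u v x : (lie u v)@_x =
  \sum_(a <- msupp u) \sum_(b <- msupp v)
    u@_a * v@_b * (Bq_coef q a b)%:~R *+ (a + b == x).
Proof.
rewrite /lie /= /Bq_lie /malg_lift raddf_sum; apply: eq_bigr => a _ /=.
rewrite mcoeffZ raddf_sum mulr_sumr; apply: eq_bigr => b _ /=.
rewrite !mcoeffZ /Lgen mcoeffU -[(_, _)]/(a + b).
by rewrite mulrnAr mulr1 !mulrnAr mulrA.
Qed.

(** The condition [phi x <= phi a ?= iff (x == a)] makes a the unique maximum,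
    so that only one pair of exponents contributes to the top of a bracket. *)
Definition leads (phi : int * nat -> int) a u : Prop :=
  u@_a != 0 /\ forall x, u@_x != 0 -> phi x <= phi a ?= iff (x == a).

Lemma leads_gen phi a : leads phi a (<< a >> : B).
Proof.
split=> [|x]; first by rewrite mcoeffUU oner_neq0.
have [->|ax] := eqVneq x a; last first.
  by rewrite mcoeffU [a == x]eq_sym (negPf ax) eqxx.
by move=> _; split; rewrite ?eqxx.
Qed.

(** Every exponent of [lie u v] is a sum x + y of exponents of u and v, and
    phi (x + y) reaches phi (a + b) only for (x, y) = (a, b): the coefficient at
    a + b is a single product and cannot be cancelled. *)
Lemma leads_lie (phi : int * nat -> int) a b u v :
    {morph phi : x y / x + y} ->
    leads phi a u -> leads phi b v -> Bq_coef q a b != 0 ->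
  leads phi (a + b) (lie u v).
Proof.
move=> phiD [ua lea] [vb leb] abN0.
have le x y : u@_x != 0 -> v@_y != 0 ->
    phi (x + y) <= phi (a + b) ?= iff ((x == a) && (y == b)).
  by move=> ux vy; rewrite !phiD; apply: leifD; [exact: lea | exact: leb].
split.
  rewrite mcoeff_lieE (bigD1_seq a) ?fset_uniq -?mcoeff_neq0 //=.
  rewrite (bigD1_seq b) ?fset_uniq -?mcoeff_neq0 //= eqxx mulr1n.
  rewrite !big1_seq ?addr0 ?mulf_neq0 ?intr_eq0 //.
    move=> x /andP[xa xu]; apply: big1_seq => y /andP[_ yv].
    rewrite -mcoeff_neq0 in xu; rewrite -mcoeff_neq0 in yv.
    case: eqP => // xyab; have := (le x y xu yv).2.
    by rewrite xyab eqxx (negPf xa).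
  move=> y /andP[yb yv]; rewrite -mcoeff_neq0 in yv.
  case: eqP => // xyab; have := (le a y ua yv).2.
  by rewrite xyab eqxx (negPf yb) andbF.
move=> z; rewrite mcoeff_lieE => zN0.
have [x [y [ux vy <-]]] : exists x y, [/\ u@_x != 0, v@_y != 0 & x + y = z].
  apply: contrapT => no; case/negP: zN0; apply/eqP.
  apply: big1_seq => x /andP[_]; rewrite -mcoeff_neq0 => ux.
  apply: big1_seq => y /andP[_]; rewrite -mcoeff_neq0 => vy.
  by case: eqP => // xyz; case: no; exists x, y.
have lexy := le x y ux vy; split; first exact: lexy.1.
rewrite lexy.2; apply/idP/eqP => [/andP[/eqP-> /eqP->] //|xyab].
by rewrite -lexy.2 xyab.
Qed.

(** The part of the structure constant that is bilinear in the exponents is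
    alternating, so along the ray b + k a only the linear part (b_1 - a_1) q
    changes, by a_1 q at each step. *)
Lemma Bq_coefDl a b k :
  Bq_coef q a (b + a *+ k) = Bq_coef q a b + a.1 * q%:Z *+ k.
Proof.
have -> : b + a *+ k = (b.1 + a.1 * k%:Z, (b.2 + a.2 * k)%N).
  elim: k => [|k IHk].
    by rewrite addr0 mulr0 addr0 muln0 addn0; case: (b).
  rewrite mulrSr addrA IHk; congr pair; first by rewrite /= intS; ring.
  by rewrite mulnSr addnA.
rewrite /Bq_coef /= -mulr_natr natz !PoszD PoszM.
by ring.
Qed.

(** In terms of k the structure constant is an arithmetic progression of step
    a_1 q; it avoids 0 as soon as its first term is nonzero and has the sign of
    a_1, or is any nonzero number when a_1 = 0. *)
Lemma exists_Bq_coef_neq0 a : (0 < q)%N ->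
  exists b, forall k, Bq_coef q a (b + a *+ k) != 0.
Proof.
move=> q_gt0; have [a0|aN0] := eqVneq a.1 0.
  by exists (1, 0%N) => k; rewrite Bq_coefDl a0 /Bq_coef /= a0; lia.
(* b_1 = 2 a_1 outweighs the contribution - a_1 q of the second product. *)
exists (a.1 *+ 2, 0%N) => k.
have -> : Bq_coef q a ((a.1 *+ 2, 0%N) + a *+ k) =
          a.1 * (2 * a.2 + q + k * q)%N%:Z.
  by rewrite Bq_coefDl /Bq_coef /=; lia.
by rewrite mulf_neq0 //; lia.
Qed.

Lemma leads_iter_ad phi a b F k : {morph phi : x y / x + y} ->
  leads phi a F -> (forall k, Bq_coef q a (b + a *+ k) != 0) ->
  leads phi (b + a *+ k) (iter k (ad F) (<< b >> : B)).
Proof.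
move=> phiD leF abN0; elim: k => [|k IHk].
  by rewrite addr0; exact: leads_gen.
by rewrite iterS mulrS addrCA; exact: leads_lie.
Qed.

(** With b as in [exists_Bq_coef_neq0], a finite set supporting all the iterates
    of L_b would contain all the points b + k a, which phi separates. *)
Lemma leads_not_ad_locally_finite phi a F : (0 < q)%N ->
  {morph phi : x y / x + y} -> leads phi a F -> 0 < phi a ->
  ~ ad_locally_finite F.
Proof.
move=> q_gt0 phiD leF phia_gt0 finF.
have [b abN0] := exists_Bq_coef_neq0 a q_gt0.
have [d supp_d] := finite_dimensional_supp (finF << b >>).
have in_d k : b + a *+ k \in d.
  apply: (fsubsetP (supp_d (iter k (ad F) << b >>) _)).
    by apply: sub_gen_smallest; exists k.
  by rewrite -mcoeff_neq0; exact: (leads_iter_ad k phiD leF abN0).1.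
have phiE k : phi (b + a *+ k) = phi b + phi a *+ k.
  elim: k => [|k IHk]; first by rewrite !addr0.
  by rewrite mulrSr addrA phiD IHk -addrA -mulrSr.
pose s := [seq b + a *+ k | k <- iota 0 #|`d|.+1].
suff: (size s <= size d)%N by rewrite size_map size_iota ltnn.
apply: uniq_leq_size => [|_ /mapP[k _ ->]] //.
rewrite map_inj_uniq ?iota_uniq // => j k /(congr1 phi).
by rewrite (phiE j) (phiE k) => /addrI /(mulrIn (lt0r_neq0 phia_gt0)).
Qed.

(** The function phi is a large multiple of the degree i plus or minus alpha.
    On the support of F it orders exponents lexicographically, hence is
    injective and has a unique maximum; the sign is chosen to make phi x
    positive, and the maximum is at least phi x. *)
Lemma exists_leads F x : F@_x != 0 -> x != 0 ->
  exists phi a, [/\ {morph phi : x y / x + y}, leads phi a F & 0 < phi a].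
Proof.
move=> Fx xN0.
(* M has to exceed every difference of two values of alpha; twice the sum of
   all the absolute values bounds them. *)
pose M : int := (\sum_(y <- msupp F) `|y.1|%N)%N.*2.+1.
have ltM y : F@_y != 0 -> `|y.1| *+ 2 < M.
  rewrite mcoeff_neq0 => yF; rewrite /M (big_fsetD1 y) //=; lia.
have M_gt0 : 0 < M by [].
clearbody M.
pose s : int := if x.1 < 0 then -1 else 1.
pose phi (y : int * nat) := M * y.2%:Z + s * y.1.
have s1 : s = 1 \/ s = -1 by rewrite /s; case: ifP; [right|left].
have phi_inj y z : F@_y != 0 -> F@_z != 0 -> phi y = phi z -> y = z.
  move=> /ltM yM /ltM zM.
  rewrite /phi; case: y z yM zM => [y i] [z j] /= yM zM yz.
  have ij : i = j by case: s1 yz => -> yz; nia.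
  by rewrite ij in yz *; congr pair; case: s1 yz => -> yz; lia.
have xF : x \in msupp F by rewrite -mcoeff_neq0.
pose a := [arg max_(y > [` xF]%fset) phi (val y)]%O.
have lea y : F@_y != 0 -> phi y <= phi (val a).
  rewrite mcoeff_neq0 => yF; rewrite /a.
  by case: arg_maxP => // z _ /(_ [` yF]%fset isT).
have Fa : F@_(val a) != 0 by rewrite mcoeff_neq0; exact: valP.
exists phi, (val a); split.
- move=> y z; rewrite /phi -[(y + z).1]/(y.1 + z.1) -[(y + z).2]/(y.2 + z.2)%N.
  by rewrite PoszD; ring.
- split=> // y Fy; split; first exact: lea.
  by apply/eqP/eqP => [|->//]; exact: phi_inj.
apply: lt_le_trans (lea x Fx).
have: (x.1 != 0) || (x.2 != 0%N) by move: xN0; rewrite -negb_and; case: (x).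
move: (ltM x Fx) M_gt0; rewrite /phi /s; move: x.1 x.2 => m j.
have [->|jN0] := eqVneq j 0%N; first by case: ifP; lia.
by case: ifP; nia.
Qed.

(** * Locally finite and locally nilpotent elements *)

Lemma ad_locally_finite_scalar F : (0 < q)%N -> ad_locally_finite F ->
  exists c : R[i], F = c *: Lgen R q 0 0%N.
Proof.
move=> q_gt0 finF; exists F@_(0, 0%N); apply/malgP => x.
rewrite mcoeffZ mcoeffU eq_sym.
have [->|xN0] := eqVneq x (0, 0%N); first by rewrite mulr1.
rewrite mulr0; apply/eqP; apply: contraT => Fx.
have [phi [a [phiD leF phia]]] := exists_leads Fx xN0.
by case: (leads_not_ad_locally_finite q_gt0 phiD leF phia).
Qed.

Lemma mcoeff_iter_ad_L00 (c : R[i]) v b m :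
  (iter m (ad (c *: Lgen R q 0 0%N)) v)@_b =
  (c * (b.1 * q%:Z)%:~R) ^+ m * v@_b.
Proof.
elim: m => [|m IHm]; first by rewrite mul1r.
rewrite iterS exprS -mulrA -{}IHm /ad; move: (iter m _ v) => w.
have -> : lie (c *: Lgen R q 0 0%N) w = c *: lie (Lgen R q 0 0%N) w.
  exact: (GRing.scalable_linear (lie_linearl w)).
rewrite mcoeffZ -mulrA; congr (_ * _).
rewrite mcoeff_lieE msuppU oner_eq0 big_seq_fset1 mcoeffUU.
rewrite (eq_bigr
  (fun b' => w@_b' * (Bq_coef q (0, 0%N) b')%:~R *+ (b' == b))); last first.
  by move=> b' _; rewrite add0r mul1r.
have coefE : Bq_coef q (0, 0%N) b = b.1 * q%:Z.
  by rewrite /Bq_coef /= mul0r subr0.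
have [wb0|wbN0] := eqVneq w@_b 0.
  rewrite wb0 mulr0; apply: big1_seq => b' _.
  by case: eqP => // ->; rewrite wb0 mul0r.
rewrite (bigD1_seq b) ?fset_uniq -?mcoeff_neq0 //= eqxx mulr1n coefE mulrC.
by rewrite big1 ?addr0 // => b' /negPf ->.
Qed.

(** Coefficientwise, applying X^m to ad is multiplying by lam b ^+ m, and
    lam b ^+ m is the value at lam b of the remainder of X^m modulo P, because
    lam b is a root of P for b in the support of v. *)
Lemma ad_locally_finite_L00 (c : R[i]) :
  ad_locally_finite (c *: Lgen R q 0 0%N).
Proof.
move=> v; pose lam (b : int * nat) : R[i] := c * (b.1 * q%:Z)%:~R.
pose P := \prod_(l <- [seq lam b | b <- msupp v]) ('X - l%:P).
apply: (@finite_dimensional_iter _ _ _ _ (size P).-1) => m.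
have sP : (size ('X^m %% P)%R <= (size P).-1)%N.
  have : P != 0 by apply: monic_neq0; exact: monic_prod_XsubC.
  by rewrite -(ltn_modp 'X^m%R); case: (size P).
suff -> : iter m (ad (c *: Lgen R q 0 0%N)) v =
    \sum_(k < (size P).-1)
      ('X^m %% P)`_k *: iter k (ad (c *: Lgen R q 0 0%N)) v.
  by apply: linear_span_sum => k; exists (nat_of_ord k) => //=.
apply/malgP => b; rewrite raddf_sum /= mcoeff_iter_ad_L00.
under eq_bigr do rewrite mcoeffZ mcoeff_iter_ad_L00 mulrA.
rewrite -mulr_suml; have [->|vb] := eqVneq v@_b 0; first by rewrite !mulr0.
rewrite -(horner_coef_wide _ sP); congr (_ * _).
have /eqP Pb0 : P.[lam b] == 0.
  by rewrite -/(root P (lam b)) root_prod_XsubC map_f // -mcoeff_neq0.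
have := congr1 (horner^~ (lam b)) (divp_eq 'X^m P).
by rewrite hornerD hornerM Pb0 mulr0 add0r hornerXn.
Qed.

Lemma L00_not_ad_locally_nilpotent (c : R[i]) : (0 < q)%N -> c != 0 ->
  ~ ad_locally_nilpotent (c *: Lgen R q 0 0%N).
Proof.
move=> q_gt0 cN0 nil; have [N /andP[_ /eqP]] := nil (Lgen R q 1 0%N).
move/(congr1 (mcoeff (1, 0%N))).
rewrite mcoeff_iter_ad_L00 mcoeffUU mulr1 mcoeff0.
by apply/eqP; rewrite expf_neq0 // mulf_neq0 // intr_eq0 mul1r -lt0n.
Qed.

Lemma exp_ad_id (x : B) (nil_x : ad_locally_nilpotent x) : (0 < q)%N ->
  exp_ad nil_x = id.
Proof.
move=> q_gt0; have [c xE] :=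
  ad_locally_finite_scalar q_gt0 (ad_nilpotent_locally_finite nil_x).
have c0 : c = 0.
  apply/eqP; apply: contraT => cN0; move: (nil_x); rewrite xE.
  by move/(L00_not_ad_locally_nilpotent q_gt0 cN0).
(* The series is cut at a positive index, so the term of index 0, which is v,
   is present. *)
apply/funext => v; rewrite /exp_ad; case: ex_minnP => -[|n] //= _ _.
rewrite big_ord_recl big1 /= ?addr0 ?invr1 ?scale1r // => k _.
suff -> : ad x = fun=> 0 by rewrite scaler0.
apply/funext => w; rewrite xE c0.
by have /= := GRing.scalable_linear (lie_linearl w) 0 0; rewrite !scale0r.
Qed.

End Leading.

Lemma Aut_subgroup_id (K : numFieldType) (L : lieAlgType K) :
  Aut_subgroup [set (id : L -> L)].
Proof.
split=> [_ ->| |_ _ -> ->|_ g -> _ gK] //; last exact/funext.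
by split=> //; exists id.
Qed.

Theorem lemma2p1 (R : realType) (q : nat) (q_gt0 : (0 < q)%N) :
  (forall F : Bq R q,
     ad_locally_finite F <-> exists c : R[i], F = c *: Lgen R q 0 0%N) /\
  (~ ad_locally_nilpotent (Lgen R q 0 0%N) /\ Int (Bq R q) = [set id]).
Proof.
split=> [F|]; first split=> [|[c ->]].
- exact: ad_locally_finite_scalar.
- exact: ad_locally_finite_L00.
split.
  rewrite -[Lgen _ _ _ _]scale1r.
  by apply: L00_not_ad_locally_nilpotent; rewrite ?oner_neq0.
apply/seteqP; split=> [|_ -> H [[_ Hid _ _] _] //].
apply: smallest_sub; first exact: Aut_subgroup_id.
by move=> _ [x [nil_x ->]]; exact: exp_ad_id.
Qed.
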